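(* Let $\kappa>1$ and $\beta>0$. Let $a_1>0$ be an absolute constant and consider $$\epsilon_n=a_1n^{-\frac{\beta(\kappa-1)}{\beta(2\kappa-1)+d(\kappa-1)}}.$$ The aggregate $\tilde f_n^{\epsilon}$ (defined in the context) with $\epsilon=\epsilon_n$ satisfies, for any $\pi\in\mathcal P_{\kappa,\beta}$ and any integer $n\ge1$, the inequality $$\mathbb E_\pi\left[R(\tilde f_n^{\epsilon_n})-R^*\right]\le C_2(\kappa,\beta,d)\,n^{-\frac{\beta\kappa}{\beta(2\kappa-1)+d(\kappa-1)}},$$ where $$C_2(\kappa,\beta,d)=2\max\left(4(2c_0\mu_{max})^{\kappa/(\kappa-1)},\;C\,A(\beta,d)^{\frac{\kappa}{2\kappa-1}}\right)\left(a_1^{\frac{\kappa}{\kappa-1}}\vee a_1^{-\frac{d\kappa}{\beta(\kappa-1)}}\right)$$ and $C$ is the constant appearing in the exponential-weights oracle inequality recalled in the context (with $a=1$).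
   Context: Setting: $(X,Y)$ has values in $\mathcal X\times\{-1,1\}$ and distribution $\pi$, with $\mathcal X=[0,1]^d$; $P^X$ is the marginal of $\pi$ on $\mathcal X$; $\eta(x)=\mathbb P(Y=1\mid X=x)$; $(X_i,Y_i)_{i=1,\dots,n}$ are i.i.d. with law $\pi$. A prediction rule is a measurable $f:\mathcal X\to\{-1,1\}$ with misclassification error $R(f)=\mathbb P(Y\ne f(X))$. For real valued $f$, $R(f)$ is the misclassification error of $\mathrm{sign}(f)$; for data-dependent $f$ it is taken conditionally on the sample, and $\mathbb E_\pi$ averages over the sample. Bayes rule: $f^*=\mathrm{sign}(2\eta-1)$, $R^*=R(f^* )=\min_fR(f)$. Notation: $x\vee y=\max(x,y)$. Margin assumption MA($\kappa$): there exists $c_0>0$ such that $\mathbb E|f(X)-f^*(X)|\le c_0(R(f)-R^* )^{1/\kappa}$ for all measurable $f:\mathcal X\to\{-1,1\}$. Hölder class: for $\beta,L>0$, $\lfloor\beta\rfloor$ is the maximal integer strictly less than $\beta$, and $\Sigma(\beta,L,[0,1]^d)$ is the set of all real valued functions $g$ on $[0,1]^d$ that are $\lfloor\beta\rfloor$-times continuously differentiable on $(0,1)^d$ and satisfy $|g(y)-g_x(y)|\le L\|x-y\|^\beta$ for all $x,y\in(0,1)^d$, where $g_x(y)=\sum_{|s|\le\lfloor\beta\rfloor}\frac{(y-x)^s}{s!}D^sg(x)$ is the Taylor polynomial of $g$ at $x$ (multi-index notation) and $\|\cdot\|$ is the Euclidean norm. Model: $\mathcal P_{\kappa,\beta}$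 is the set of all probability measures $\pi$ on $\mathcal X\times\{-1,1\}$ such that: (1) MA($\kappa$) is satisfied; (2) $P^X$ is absolutely continuous with respect to the Lebesgue measure on $[0,1]^d$, and there exists a version of its density which is upper bounded by $\mu_{max}<\infty$; (3) $\eta\in\Sigma(\beta,L,[0,1]^d)$. Net and aggregate: for any $\epsilon>0$, $\Sigma_\epsilon(\beta)$ is an $\epsilon$-net on $\Sigma(\beta,L,[0,1]^d)$ for the $L^\infty$-norm such that $\log\mathrm{Card}(\Sigma_\epsilon(\beta))\le A(\beta,d)\epsilon^{-d/\beta}$, where $A(\beta,d)$ is a constant depending only on $\beta$ and $d$ (from the Kolmogorov–Tikhomirov bound on the $\epsilon$-entropy of the Hölder class). For $\bar\eta\in\Sigma_\epsilon(\beta)$ put $f_{\bar\eta}(x)=2\cdot\mathbf 1_{\{\bar\eta(x)\ge1/2\}}-1$, and $$\tilde f_n^\epsilon=\sum_{\bar\eta\in\Sigma_\epsilon(\beta)}w^{(n)}(f_{\bar\eta})f_{\bar\eta},\qquad w^{(n)}(f_{\bar\eta})=\frac{\exp\left(\sum_{i=1}^nY_if_{\bar\eta}(X_i)\right)}{\sum_{\eta'\in\Sigma_\epsilon(\beta)}\exp\left(\sum_{i=1}^nY_if_{\eta'}(X_i)\right)}.$$ Oracle inequality referred to: for $\kappa\ge1$, $M\ge3$, prediction rules $f_1,\dots,f_M$ and $\tilde f_n=\sum_{j=1}^Mw_jf_j$ with $w_j=\exp(\sum_{i=1}^nY_if_j(X_i))/\sum_{k=1}^M\exp(\sum_{i=1}^nY_if_k(X_i))$,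 if $\pi$ satisfies MA($\kappa$), then for any $a>0$ and any integers $n,M$, $\mathbb E[R(\tilde f_n)-R^*]\le2(1+a)\min_j(R(f_j)-R^* )+C(\log M/n)^{\kappa/(2\kappa-1)}$, with $C>0$ a constant depending only on $a$.
   Formalization: The Hölder class as defined contains all constants, so it has no finite ε-net; here the net (of measurable functions) need only cover the members of the class with values in [0,1], in essential sup norm. C is any constant for which the oracle inequality holds for the given κ, c_0 and d. *)

(* Defs.v *)
From HB Require Import structures.
From mathcomp Require Import all_boot all_order all_algebra finmap.
From mathcomp Require Import all_classical all_reals all_analysis.

Set Implicit Arguments.
Unset Strict Implicit.
Unset Printing Implicit Defensive.

Import Order.TTheory GRing.Theory Num.Theory.
Import numFieldNormedType.Exports.

Local Open Scope classical_set_scope.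
Local Open Scope ring_scope.

Section product_probability.
Context {d : measure_display} {T : measurableType d} {R : realType}.

Definition cons_pair (n : nat) (p : T * n.-tuple T) : n.+1.-tuple T :=
  [tuple of p.1 :: p.2].

Lemma measurable_cons_pair (n : nat) :
  measurable_fun [set: T * n.-tuple T] (@cons_pair n).
Proof. by apply: measurable_cons. Qed.

HB.instance Definition _ (n : nat) :=
  isMeasurableFun.Build _ _ _ _ (@cons_pair n) (@measurable_cons_pair n).

(* The n-fold product of P with itself, i.e. the law of n i.i.d. draws from
   P. *)
Fixpoint prob_power (P : probability T R) (n : nat) :
    probability (n.-tuple T) R :=
  match n with
  | 0 => dirac [tuple]
  | m.+1 => distribution (P \x prob_power P m)%E (@cons_pair m)
  end.

End product_probability.

Section marginal.
Context {d1 d2 : measure_display} {T1 : measurableType d1}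
  {T2 : measurableType d2} {R : realType}.

HB.instance Definition _ :=
  isMeasurableFun.Build _ _ _ _ (@fst T1 T2) measurable_fst.

Definition marginal (pi : probability (T1 * T2)%type R) : probability T1 R :=
  distribution pi fst.

End marginal.

Section lebesgue_unit_interval.
Context {R : realType}.

Definition to_real : measurableTypeR R -> R := idfun.

HB.instance Definition _ := @isMeasurableFun.Build _ _ _ _ to_real
  (@measurable_id _ _ [set: measurableTypeR R]).

(* The Lebesgue measure on [0,1]; [to_real] is the identity, and serves to move
   from [measurableTypeR R] to the measurable structure of R itself. *)
Definition unit_lebesgue : probability R R :=
  distribution (uniform_prob (@ltr01 R)) to_real.

End lebesgue_unit_interval.

Section smooth_functions.
Context {R : realType} {d : nat}.
Implicit Types (g : 'rV[R]_d -> R) (v w : 'rV[R]_d).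

Definition open_cube : set 'rV[R]_d := [set v | forall i, 0 < v ord0 i < 1].

Definition partial (i : 'I_d) g : 'rV[R]_d -> R :=
  fun v => 'D_(delta_mx ord0 i) g v.

(* k-times continuously differentiable on the open cube: the function is
   continuous there and, for k > 0, its first partial derivatives exist there
   and are (k-1)-times continuously differentiable. *)
Fixpoint cont_diff (k : nat) g : Prop :=
  (forall v, open_cube v -> {for v, continuous g}) /\
  match k with
  | 0 => True
  | m.+1 => forall i : 'I_d,
      (forall v, open_cube v -> derivable g v (delta_mx ord0 i)) /\
      cont_diff m (partial i g)
  end.

(* D^s g for a multi-index s; on [cont_diff] functions the order of the
   differentiations is irrelevant. *)
Definition multi_partial (s : 'I_d -> nat) g : 'rV[R]_d -> R :=
  foldr (fun i h => iter (s i) (partial i) h) g (enum 'I_d).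

(* g_v(w), with g_v the Taylor polynomial of g at v of degree k; multi-indices
   of weight at most k have all their entries at most k. *)
Definition taylor (k : nat) g v w : R :=
  \sum_(s : {ffun 'I_d -> 'I_k.+1} | (\sum_i s i <= k)%N)
    (\prod_i (w ord0 i - v ord0 i) ^+ s i) / (\prod_i (s i)`!)%N%:R
    * multi_partial (fun i => s i) g v.

Definition euclidean_norm v : R := Num.sqrt (\sum_i v ord0 i ^+ 2).

(* The maximal integer strictly less than b, for b > 0. *)
Definition strict_floor (b : R) : nat := `|Num.ceil b|%N.-1.

Definition hoelder_class (beta L : R) : set ('rV[R]_d -> R) :=
  [set g | cont_diff (strict_floor beta) g /\
    forall v w, open_cube v -> open_cube w ->
      `|g w - taylor (strict_floor beta) g v w|
        <= L * euclidean_norm (v - w) `^ beta].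

End smooth_functions.

(* Inputs are d-tuples of reals with the product sigma-algebra; the input space
   [0,1]^d is the subset [cube] of it.  The labels 1 and -1 are encoded by true
   and false.  Functions on the input space are functions on all d-tuples of
   which only the values on [cube] matter, as the distributions considered are
   carried by [cube]. *)
Section classification.
Context {R : realType} {d : nat}.
Local Notation input := (d.-tuple R).
Local Notation obs := (d.-tuple R * bool)%type.
Implicit Types (pi : probability obs R) (f h eta : input -> R).

Definition cube : set input := [set x | forall i, 0 <= tnth x i <= 1].

(* The Lebesgue measure on [0,1]^d, as the product of d copies of the Lebesgue
   measure on [0,1]. *)
Definition cube_lebesgue : probability input R :=
  prob_power unit_lebesgue d.

Definition of_row (v : 'rV[R]_d) : input := [tuple v ord0 i | i < d].

Definition label (y : bool) : R := if y then 1 else -1.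

(* With sign 0 = 1, sign (2 h - 1) is the plug-in rule 2 1_{h >= 1/2} - 1. *)
Definition sign (t : R) : R := if 0 <= t then 1 else -1.

Definition prediction_rule f : Prop :=
  measurable_fun setT f /\ forall x, f x = 1 \/ f x = -1.

Definition risk pi f : R := fine (pi [set z | label z.2 != sign (f z.1)]).

Definition carried_by_cube pi : Prop := pi (cube `*` [set: bool]) = 1%E.

(* eta is a version of x |-> P(Y = 1 | X = x), with values in [0,1]. *)
Definition regression_function pi eta : Prop :=
  [/\ measurable_fun setT eta,
      forall x, cube x -> 0 <= eta x <= 1 &
      forall B : set input, measurable B ->
        pi (B `*` [set true]) = (\int[marginal pi]_(x in B) (eta x)%:E)%E].

Definition bayes_rule eta : input -> R := fun x => sign (2 * eta x - 1).

Definition excess_risk pi eta f : R := risk pi f - risk pi (bayes_rule eta).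

Definition margin_assumption (kappa c0 : R) pi eta : Prop :=
  forall f, prediction_rule f ->
    ('E_pi[fun z => (`|f z.1 - bayes_rule eta z.1|)%R]
      <= (c0 * excess_risk pi eta f `^ kappa^-1)%:E)%E.

Definition bounded_density (mu_max : R) pi : Prop :=
  marginal pi `<< cube_lebesgue /\
  exists p : input -> R,
    [/\ measurable_fun setT p,
        forall x, 0 <= p x <= mu_max &
        forall B : set input, measurable B ->
          marginal pi B = (\int[cube_lebesgue]_(x in B) (p x)%:E)%E].

(* The class P_{kappa,beta}; its elements come with the version eta of the
   regression function that belongs to the Hoelder class. *)
Definition model (kappa beta L c0 mu_max : R) pi eta : Prop :=
  [/\ carried_by_cube pi, regression_function pi eta,
      margin_assumption kappa c0 pi eta,
      bounded_density mu_max pi &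
      hoelder_class beta L (eta \o of_row)].

Definition exp_weight (n : nat) (s : n.-tuple obs) f : R :=
  expR (\sum_(i < n) label (tnth s i).2 * f (tnth s i).1).

Definition aggregate (I : finType) (f : I -> input -> R)
    (n : nat) (s : n.-tuple obs) : input -> R :=
  fun x => \sum_j (exp_weight s (f j) / \sum_k exp_weight s (f k)) * f j x.

(* C is an admissible constant in the oracle inequality for aggregation with
   exponential weights, for the given value of a and the given parameters of
   the margin assumption. *)
Definition oracle_inequality (kappa c0 a C : R) : Prop :=
  forall pi eta, carried_by_cube pi -> regression_function pi eta ->
  margin_assumption kappa c0 pi eta ->
  forall (n M : nat) (f : 'I_M -> input -> R),
    (1 <= n)%N -> (3 <= M)%N -> (forall j, prediction_rule (f j)) ->
    ('E_(prob_power pi n)[fun s => excess_risk pi eta (aggregate f s)]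
      <= (2 * (1 + a))%:E
           * \big[Order.min/+oo]_(j < M) (excess_risk pi eta (f j))%:E
         + (C * (ln M%:R / n%:R) `^ (kappa / (2 * kappa - 1)))%:E)%E.

(* The Hoelder class contains all constants, hence has no finite net for the
   L^oo norm; what the net has to approximate are the possible regression
   functions, i.e. the members of the class with values in [0,1].  The points
   of a net need not belong to the class. *)
Definition epsilon_net (beta L eps : R) (S : {fset (input -> R)}) : Prop :=
  (forall h, h \in S -> measurable_fun setT h) /\
  forall g : input -> R, hoelder_class beta L (g \o of_row) ->
    (forall x, cube x -> 0 <= g x <= 1) ->
    exists2 h, h \in S &
      ('N[cube_lebesgue]_+oo[EFin \o (g \- h)%R] <= eps%:E)%E.

Definition plug_in h : input -> R :=
  fun x => 2 * \1_[set u | 2^-1 <= h u] x - 1.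

Definition net_aggregate (S : {fset (input -> R)}) (n : nat)
    (s : n.-tuple obs) : input -> R :=
  aggregate (fun h : S => plug_in (val h)) s.

End classification.

Section constants.
Context {R : realType}.

Definition rate_denominator (d : nat) (kappa beta : R) : R :=
  beta * (2 * kappa - 1) + d%:R * (kappa - 1).

Definition epsilon_n (d : nat) (kappa beta a1 : R) (n : nat) : R :=
  a1 * n%:R `^ (- (beta * (kappa - 1) / rate_denominator d kappa beta)).

Definition C2 (d : nat) (kappa beta c0 mu_max a1 A C : R) : R :=
  2 * Num.max (4 * (2 * c0 * mu_max) `^ (kappa / (kappa - 1)))
              (C * A `^ (kappa / (2 * kappa - 1)))
    * Num.max (a1 `^ (kappa / (kappa - 1)))
              (a1 `^ (- (d%:R * kappa / (beta * (kappa - 1))))).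

End constants.

(* Main.v *)
Require Import Defs.
From mathcomp Require Import all_boot all_order all_algebra finmap.
From mathcomp Require Import all_classical all_reals all_analysis.
From mathcomp Require Import measurable_realfun ess_sup_inf ring lra.

Set Implicit Arguments.
Unset Strict Implicit.
Unset Printing Implicit Defensive.

Import Order.TTheory GRing.Theory Num.Theory.
Import numFieldNormedType.Exports.

Local Open Scope classical_set_scope.
Local Open Scope ring_scope.

(** The oracle inequality reduces the theorem to two estimates for the plug-in
    rules of the net at scale e = epsilon_n: the smallest excess risk among them,
    and the logarithm of their number.

    For the first, the net contains a function h with |eta - h| <= e almost
    everywhere.  Its plug-in rule differs from the Bayes rule only where
    |2 eta - 1| <= 2 e, so that its excess risk is at most e times the expected
    disagreement E|f_h - f*| ([excess_risk_plug_in]).  The margin assumption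
    bounds this expectation by c0 times the power 1/kappa of the same excess
    risk, and solving for the excess risk gives (c0 e)^(kappa/(kappa-1))
    ([excess_risk_plug_in_margin]).  A density on the cube bounded by mu_max
    forces mu_max >= 1, so that this is at most the power of 2 c0 mu_max e that
    the constant C2 contains.  For the second, the entropy bound is an assumption,
    and epsilon_n balances the two terms ([approximation_rate], [entropy_rate]).

    The oracle inequality speaks of at least three rules, and a coarse net may
    have fewer points.  If e < 1/4 there are always three, because the constants
    0, 1/2 and 1 belong to the Hoelder class and no function is within e of two of
    them ([epsilon_net_ge3]).  If e >= 1/4 the claim is weaker than the trivial
    bound 1 on the excess risk: the margin assumption for the rule opposite to
    the Bayes rule forces c0 >= 2 ([margin_constant_ge2]), and then the right-hand
    side is at least 8. *)

(** * Constants in the Hoelder class *)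

Section constant_functions.
Context {R : realType} {d : nat}.

Lemma partial_cst (i : 'I_d) (c : R) : partial i (cst c) = cst 0.
Proof. by apply/funext => v; rewrite /partial derive_cst. Qed.

Lemma cont_diff_cst k (c : R) : cont_diff k (cst c : 'rV[R]_d -> R).
Proof.
have cst_cont (c' : R) (v : 'rV[R]_d) :
  open_cube v -> {for v, continuous (cst c' : 'rV[R]_d -> R)}.
  by move=> _; exact: cst_continuous.
elim: k c => [|k ih] c; split; try exact: cst_cont.
  by [].
move=> i.
by rewrite partial_cst; split=> // v _; exact: derivable_cst.
Qed.

(** A mixed derivative of a constant is the constant itself for the empty
    multi-index, and one differentiation already gives 0 otherwise. *)
Lemma multi_partial_cst (s : 'I_d -> nat) (c : R) :
  multi_partial s (cst c) = cst (if [forall i, s i == 0%N] then c else 0).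
Proof.
have iter0 (i : 'I_d) n : iter n (partial i) (cst 0) = cst (0 : R).
  by elim: n => //= n ->; rewrite partial_cst.
rewrite (_ : [forall i, _] = all (fun i => s i == 0%N) (enum 'I_d)); last first.
  by apply/forallP/allP => [s0 i _|s0 i]; [exact: s0 | rewrite s0// mem_enum].
rewrite /multi_partial; elim: (enum 'I_d) => //= i r ->.
have [-> //|] := eqVneq (s i) 0%N; case: (s i) => // n _.
by rewrite iterSr partial_cst iter0.
Qed.

Lemma taylor_cst k (c : R) (v w : 'rV[R]_d) : taylor k (cst c) v w = c.
Proof.
rewrite /taylor (bigD1 [ffun=> ord0]) /=; last first.
  by rewrite big1// => i _; rewrite ffunE.
rewrite [X in _ + X]big1 ?addr0; last first.
  move=> s /andP[_ s0]; rewrite multi_partial_cst ifF ?mulr0//.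
  apply: contraNF s0 => /forallP s0; apply/eqP/ffunP => i.
  by rewrite ffunE; apply/val_inj/eqP; exact: s0.
rewrite multi_partial_cst ifT; last by apply/forallP => i; rewrite ffunE.
rewrite !big1 ?invr1 ?mul1r// => i _; by rewrite ffunE ?expr0.
Qed.

Lemma hoelder_class_cst (beta L c : R) :
  0 <= L -> hoelder_class beta L (cst c : 'rV[R]_d -> R).
Proof.
move=> L0; split=> [|v w _ _]; first exact: cont_diff_cst.
by rewrite taylor_cst subrr normr0 mulr_ge0// powR_ge0.
Qed.

End constant_functions.

(** * Probabilities and expectations *)

Section probability_facts.
Context {R : realType} {dT : measure_display} {T : measurableType dT}.
Import HBNNSimple.
Implicit Types (P : probability T R) (A C : set T).

Lemma fine_probability_le1 P A : measurable A -> fine (P A) <= 1.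
Proof.
move=> mA; rewrite -lee_fin fineK ?fin_num_measure//; exact: probability_le1.
Qed.

Lemma fine_measureI P A C : measurable A -> measurable C ->
  fine (P A) = fine (P (A `&` C)) + fine (P (A `\` C)).
Proof.
move=> mA mC; rewrite (measureDI P mA mC) addeC fineD ?fin_num_measure//.
- exact: measurableI.
- exact: measurableD.
Qed.

(** No measurability is asked of X, because X will be the excess risk of an
    aggregate as a function of the sample.  The integral of the positive part of
    such an X is a supremum over simple functions below it, and each of these
    can be compared with c. *)
Lemma expectation_le_cst P (X : T -> R) (c : R) :
  0 <= c -> (forall t, X t <= c) -> ('E_P[X] <= c%:E)%E.
Proof.
move=> c0 Xc; rewrite unlock integralE.
have neg_ge0 : (0 <= \int[P]_x ((EFin \o X)^\- x))%E.
  by apply: integral_ge0 => t _; exact: funeneg_ge0.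
apply: (@le_trans _ _ (\int[P]_x ((EFin \o X)^\+ x))%E).
  by rewrite geeDl// oppe_le0.
rewrite ge0_integralTE; last by move=> t; exact: funepos_ge0.
apply: ge_ereal_sup => _ [h hX <-].
rewrite -integralT_nnsfun.
have -> : (c%:E = \int[P]_x (cst c%:E x))%E.
  by rewrite integral_cst//= probability_setT mule1.
apply: ge0_le_integral => //.
- by move=> t _; rewrite lee_fin; exact: fun_ge0.
- exact/measurable_EFinP/measurable_funP.
- move=> t _; apply: le_trans (hX t) _.
  by rewrite funeposE ge_max !lee_fin Xc c0.
Qed.

Lemma ae_exists P (Q : T -> Prop) : {ae P, forall x, Q x} -> exists x, Q x.
Proof.
move=> PQ; have P0 : (0 < P [set: T])%E by rewrite probability_setT.
have := ae_properfilter_algebraOfSetsType P0 => PF.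
exact: (@filter_ex _ _ PF _ PQ).
Qed.

End probability_facts.

(** * Excess risk of plug-in rules under the margin assumption *)

(** A quantity controlled by a power kappa^-1 < 1 of itself is bounded: divide
    by x `^ kappa^-1 and raise to the inverse of the remaining exponent
    (kappa - 1) / kappa. *)
Lemma powR_self_bound (R : realType) (kappa K x : R) : 1 < kappa -> 0 <= K ->
  x <= K * x `^ kappa^-1 -> x <= K `^ (kappa / (kappa - 1)).
Proof.
move=> k1 K0 xK; have [x0|x0] := leP x 0.
  by rewrite (le_trans x0)// powR_ge0.
have xk0 : 0 < x `^ kappa^-1 by exact: powR_gt0.
have : x `^ ((kappa - 1) / kappa) <= K.
  rewrite -(ler_pM2r xk0) -powRD; last by rewrite (gt_eqF x0) implybT.
  rewrite (_ : (kappa - 1) / kappa + kappa^-1 = 1) ?powRr1 ?(ltW x0)//.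
  by field; lra.
move=> /(@ge0_ler_powR _ (kappa / (kappa - 1))).
rewrite -powRrM (_ : (kappa - 1) / kappa * (kappa / (kappa - 1)) = 1); last first.
  by field; apply/andP; split; lra.
rewrite powRr1 ?(ltW x0)//.
apply; rewrite ?nnegrE ?powR_ge0// divr_ge0; lra.
Qed.

Section excess_risk.
Context {R : realType} {d : nat}.
Local Notation input := (d.-tuple R).
Local Notation obs := (d.-tuple R * bool)%type.
Implicit Types (f g h eta : input -> R) (B C : set input).

Lemma prediction_rule_sign f : measurable_fun setT f ->
  prediction_rule (fun x => sign (f x)).
Proof.
move=> mf; split=> [|x]; last by rewrite /sign; case: ifP; [left|right].
apply: measurable_fun_ifT => //.
exact: measurable_fun_ler.
Qed.

Lemma plug_inE h x : plug_in h x = if 2^-1 <= h x then 1 else -1.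
Proof.
rewrite /plug_in indicE; case: ifP => hx.
  by rewrite mem_set//= ; ring.
by rewrite memNset/= ?hx//; ring.
Qed.

Lemma plug_in_sign h x : plug_in h x = sign (2 * h x - 1).
Proof. rewrite plug_inE /sign; congr (if _ then _ else _); apply/idP/idP; lra. Qed.

Lemma prediction_rule_plug_in h : measurable_fun setT h ->
  prediction_rule (plug_in h).
Proof.
move=> mh; rewrite (_ : plug_in h = fun x => sign (2 * h x - 1)); last first.
  by apply/funext => x; exact: plug_in_sign.
apply: prediction_rule_sign; apply: measurable_funB => //.
exact: measurable_funM.
Qed.

Lemma prediction_rule_bayes eta : measurable_fun setT eta ->
  prediction_rule (bayes_rule eta).
Proof.
move=> mh; apply: prediction_rule_sign; apply: measurable_funB => //.
exact: measurable_funM.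
Qed.

Lemma measurable_positive f : prediction_rule f -> measurable [set x | f x = 1].
Proof.
move=> [mf _]; rewrite -[X in measurable X]setTI.
exact: (mf measurableT [set 1]).
Qed.

Variable pi : probability obs R.

(* [mass B] is the probability that X is in B, and [pmass B] that moreover the
   label is 1; for a rule that equals 1 exactly on B, the risk is an affine
   function of these two numbers. *)
Let mass B := fine (marginal pi B).
Let pmass B := fine (pi (B `*` [set true])).

Lemma marginalE B : marginal pi B = pi (B `*` [set: bool]).
Proof.
rewrite /marginal /distribution /pushforward /=; congr (pi _).
by apply/seteqP; split=> -[x y] //= [].
Qed.

Lemma measurable_rect B (Y : set bool) : measurable B -> measurable (B `*` Y).
Proof. by move=> mB; apply: measurableX. Qed.

Lemma mass_split B : measurable B ->
  mass B = pmass B + fine (pi (B `*` [set false])).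
Proof.
move=> mB; rewrite /mass marginalE.
rewrite (fine_measureI _ (measurable_rect _ mB) (measurable_rect [set true] mB)).
congr (fine (pi _) + fine (pi _)); apply/seteqP; split=> -[x y] /=.
- by move=> [].
- by move=> [].
- by move=> [[Bx _]] /not_andP[//|]; case: y.
- by move=> [Bx ->]; split=> // -[].
Qed.

Lemma pmass_split B C : measurable B -> measurable C ->
  pmass B = pmass (B `&` C) + pmass (B `\` C).
Proof.
move=> mB mC; rewrite /pmass.
rewrite (fine_measureI _ (measurable_rect _ mB) (measurable_rect [set true] mC)).
congr (fine (pi _) + fine (pi _)); apply/seteqP; split=> -[x y] /=.
- by move=> [[? ?] []].
- by move=> [[? ?] ?].
- by move=> [[Bx ?]] /not_andP[|].
- by move=> [[Bx Cx] ?]; split=> // -[].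
Qed.

Lemma pmass_ge0 B : 0 <= pmass B.
Proof. by rewrite /pmass fine_ge0. Qed.

Lemma pmass_le B : measurable B -> pmass B <= mass B.
Proof. by move=> mB; rewrite mass_split// lerDl fine_ge0. Qed.

(** Errors are made on B with label -1, which has probability mass B - pmass B,
    and off B with label 1, which has probability pmass setT - pmass B. *)
Lemma risk_rule f : prediction_rule f ->
  let B := [set x | f x = 1] in risk pi f = mass B - 2 * pmass B + pmass setT.
Proof.
move=> fr B; have mB : measurable B by exact: measurable_positive.
have [_ f1] := fr.
have mBx (Y : set bool) : measurable (B `*` Y) by exact: measurable_rect.
have mCx (Y : set bool) : measurable (~` B `*` Y).
  by apply: measurable_rect; exact: measurableC.
have n11 : (1 == -1 :> R) = false by apply/negP => /eqP; lra.
have -> : risk pi f = fine (pi (B `*` [set false])) + pmass (~` B).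
  rewrite /risk /pmass -fineD ?fin_num_measure// -measureU//; last first.
    by apply/seteqP; split=> -[x y] //= [[? ->] []].
  congr (fine (pi _)); apply/seteqP; split=> -[x y] /=; rewrite /B /= /sign.
    case: (f1 x) => ->; rewrite ?ler01 ?ler0N1; case: y => /=; rewrite ?eqxx//.
      by left.
    by right; split=> //; apply/eqP; rewrite eq_sym n11.
  case=> -[fx ->] /=.
    by rewrite fx ler01 eq_sym n11.
  by case: (f1 x) => [//|->]; rewrite ler0N1 n11.
rewrite (mass_split mB) (pmass_split measurableT mB) setTI setTD; ring.
Qed.

Variable eta : input -> R.
Hypothesis eta_reg : regression_function pi eta.

(** Removing a null set from B turns an almost sure property into one that holds at
    every point, so that integrals can be compared pointwise. *)
Lemma essential_part (Q : input -> Prop) B :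
  measurable B -> {ae marginal pi, forall x, Q x} ->
  exists C, [/\ measurable C, forall x, C x -> B x /\ Q x,
    mass C = mass B & pmass C = pmass B].
Proof.
move=> mB [N [mN N0 NQ]].
have mBN : measurable (B `&` N) by exact: measurableI.
have BN0 : mass (B `&` N) = 0.
  by rewrite /mass (subset_measure0 mBN mN) //; exact: subIsetr.
exists (B `\` N); split.
- exact: measurableD.
- move=> x [Bx Nx]; split=> //.
  by apply: contrapT => nQ; apply: Nx; exact: NQ.
- by rewrite [RHS]/mass (fine_measureI _ mB mN) -/(mass _) BN0 add0r.
- rewrite [RHS](pmass_split mB mN) (_ : pmass (B `&` N) = 0) ?add0r//.
  by apply/eqP; rewrite eq_le pmass_ge0 andbT -BN0 pmass_le.
Qed.

Lemma bounded_integrable C (h : input -> R) (a b : R) :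
  measurable C -> measurable_fun setT h -> (forall x, C x -> a <= h x <= b) ->
  (marginal pi).-integrable C (EFin \o h).
Proof.
move=> mC mh hab; apply: measurable_bounded_integrable => //.
- by rewrite (le_lt_trans (probability_le1 _ mC))// ltry.
- exact: measurable_funTS.
- exists (`|a| + `|b|); split; first exact: num_real.
  move=> M hM x /hab /andP[ax xb]; apply: le_trans (ltW hM).
  rewrite ler_norml; apply/andP; split.
    apply: le_trans ax; have := ler_norm (- a); rewrite normrN.
    by have := normr_ge0 b; lra.
  by apply: le_trans xb _; have := ler_norm b; have := normr_ge0 a; lra.
Qed.

Lemma pmass_bounds B (a b : R) : measurable B ->
  {ae marginal pi, forall x, B x -> a <= eta x <= b} ->
  a * mass B <= pmass B <= b * mass B.
Proof.
move=> mB /(essential_part mB)[C [mC CB <- <-]].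
have [meta _ etaE] := eta_reg.
have pE : ((pmass C)%:E = \int[marginal pi]_(x in C) (eta x)%:E)%E.
  by rewrite -etaE// fineK// fin_num_measure//; exact: measurable_rect.
have cE c : ((c * mass C)%:E = \int[marginal pi]_(x in C) cst c%:E x)%E.
  by rewrite integral_cst//= EFinM fineK// fin_num_measure.
have Ceta x : C x -> a <= eta x <= b by move=> /CB[Bx]; apply.
have int_eta := bounded_integrable mC meta Ceta.
have int_cst c : (marginal pi).-integrable C (cst c%:E).
  by apply: (@bounded_integrable C (cst c) c c) => // x _ /=; rewrite lexx.
rewrite -!lee_fin !cE pE; apply/andP; split; apply: le_integral => // x;
  by rewrite inE lee_fin => /Ceta/andP[].
Qed.

Definition positive_only f g : set input :=
  [set x | f x = 1] `\` [set x | g x = 1].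

(** The common part of {f = 1} and {g = 1} contributes equally to both risks, so
    that only the two sets where the rules differ remain. *)
Lemma excess_riskE f g : prediction_rule f -> prediction_rule g ->
  risk pi f - risk pi g =
    (mass (positive_only f g) - 2 * pmass (positive_only f g))
    - (mass (positive_only g f) - 2 * pmass (positive_only g f)).
Proof.
move=> fr gr; rewrite !risk_rule//=.
have [mf mg] := (measurable_positive fr, measurable_positive gr).
rewrite {1}(pmass_split mf mg) (pmass_split mg mf) /mass.
rewrite {1}(fine_measureI _ mf mg) (fine_measureI _ mg mf) /positive_only.
by rewrite [[set x | g x = 1] `&` _]setIC; ring.
Qed.

(** Two rules differ by 2 wherever they disagree, whence the factor 2. *)
Lemma expected_disagreement f g : prediction_rule f -> prediction_rule g ->
  ('E_pi[fun z => (`|f z.1 - g z.1|)%R] =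
    (2 * (mass (positive_only f g) + mass (positive_only g f)))%:E)%E.
Proof.
move=> fr gr; have [[_ f1] [_ g1]] := (fr, gr).
have [mf mg] := (measurable_positive fr, measurable_positive gr).
have mfg : measurable (positive_only f g) by exact: measurableD.
have mgf : measurable (positive_only g f) by exact: measurableD.
pose D := positive_only f g `|` positive_only g f.
have mD : measurable (D `*` [set: bool]).
  by apply: measurable_rect; exact: measurableU.
rewrite (_ : (fun z : obs => _) =
    (fun z => 2 * \1_(D `*` [set: bool]) z)); last first.
  apply/funext => -[x y] /=; rewrite indicE.
  have n11 : (-1 : R) <> 1 by lra.
  have [fx|fx] := f1 x; have [gx|gx] := g1 x.
  - rewrite fx gx subrr normr0 memNset ?mulr0//=.
    by rewrite /D /positive_only /= fx gx => -[[[]|[]]].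
  - rewrite fx gx mem_set /= /D /positive_only /= ?fx ?gx ?opprK ?ger0_norm//.
      by lra.
    by split=> //; left.
  - rewrite fx gx mem_set /= /D /positive_only /= ?fx ?gx.
      by rewrite distrC opprK ger0_norm//; lra.
    by split=> //; right.
  - rewrite fx gx subrr normr0 memNset ?mulr0//=.
    by rewrite /D /positive_only /= fx gx => -[[[]|[]]].
rewrite unlock; under eq_integral do rewrite EFinM.
rewrite ge0_integralZl_EFin//; last first.
  exact/measurable_EFinP/measurable_indic.
rewrite integral_indic// setIT EFinM; congr (_ * _)%E.
rewrite /= -marginalE /D measureU//; last first.
  by apply/seteqP; split=> x //= [[? ?] []].
by rewrite EFinD !fineK// fin_num_measure.
Qed.

(** The risk of f is that of the rule sign f, whose errors are a part of mass at
    most mass B inside B = {sign f = 1} and mass (~` B) outside. *)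
Lemma risk_le1 f : measurable_fun setT f -> risk pi f <= 1.
Proof.
move=> mf; have sfr := prediction_rule_sign mf.
have -> : risk pi f = risk pi (fun x => sign (f x)).
  have signK t : sign (sign t : R) = sign t.
    by rewrite {2 3}/sign; case: ifP => _; rewrite /sign ?ler01 ?ler0N1.
  by rewrite /risk; congr (fine (pi _)); apply/seteqP; split=> z /=; rewrite signK.
rewrite risk_rule//=; set B := [set x | _].
have mB : measurable B by exact: measurable_positive.
have -> : mass B - 2 * pmass B + pmass setT = mass B - pmass B + pmass (~` B).
  by rewrite (pmass_split measurableT mB) setTI setTD; ring.
have mCB := measurableC mB.
have : mass setT = 1 by rewrite /mass probability_setT.
rewrite /mass (fine_measureI _ measurableT mB) setTI setTD.
rewrite -/(mass B) -/(mass (~` B)).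
by have := pmass_le mCB; have := pmass_ge0 B; lra.
Qed.

Lemma excess_risk_le1 f : measurable_fun setT f -> excess_risk pi eta f <= 1.
Proof.
move=> mf; have := risk_le1 mf.
have : 0 <= risk pi (bayes_rule eta) by rewrite /risk fine_ge0.
by rewrite /excess_risk; lra.
Qed.

Lemma bayesE x : bayes_rule eta x = if 2^-1 <= eta x then 1 else -1.
Proof. by rewrite -plug_inE plug_in_sign. Qed.

(** Where the plug-in rule disagrees with the Bayes rule, h and eta lie on
    opposite sides of 1/2, so that eta is within e of 1/2.  On a set D where
    the rules differ, |mass D - 2 pmass D| is the integral of |1 - 2 eta|, hence
    at most 2 e mass D; the sum of these bounds is e times the expected
    disagreement. *)
Lemma excess_risk_plug_in h (e : R) : measurable_fun setT h ->
  {ae marginal pi, forall x, `|eta x - h x| <= e} ->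
  ((excess_risk pi eta (plug_in h))%:E
     <= e%:E * 'E_pi[fun z => (`|plug_in h z.1 - bayes_rule eta z.1|)%R])%E.
Proof.
move=> mh eta_h; have [meta _ _] := eta_reg.
have hr := prediction_rule_plug_in mh; have br := prediction_rule_bayes meta.
rewrite expected_disagreement// -EFinM lee_fin /excess_risk excess_riskE//.
have [mhp mbp] := (measurable_positive hr, measurable_positive br).
have n11 : (-1 : R) = 1 -> False by lra.
set D1 := positive_only (plug_in h) _; set D2 := positive_only _ (plug_in h).
have /andP[D1l _] : (2^-1 - e) * mass D1 <= pmass D1 <= 2^-1 * mass D1.
  apply: pmass_bounds; first exact: measurableD.
  apply: filterS eta_h => x hx [/=]; rewrite plug_inE bayesE.
  case: ifP => [h2 _|_ /n11//]; case: ifP => [_ []//|/negbT].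
  rewrite -ltNge => e2 _.
  by move: hx; rewrite ler_norml => /andP[? ?]; apply/andP; split; lra.
have /andP[_ D2u] : 2^-1 * mass D2 <= pmass D2 <= (2^-1 + e) * mass D2.
  apply: pmass_bounds; first exact: measurableD.
  apply: filterS eta_h => x hx [/=]; rewrite plug_inE bayesE.
  case: ifP => [e2 _|_ /n11//]; case: ifP => [_ []//|/negbT].
  rewrite -ltNge => h2 _.
  by move: hx; rewrite ler_norml => /andP[? ?]; apply/andP; split; lra.
by lra.
Qed.

(** The margin assumption bounds the expected disagreement by a power of the
    excess risk, which turns the preceding bound into a self-bounding one. *)
Lemma excess_risk_plug_in_margin kappa c0 h (e : R) :
  1 < kappa -> 0 <= c0 -> 0 <= e -> margin_assumption kappa c0 pi eta ->
  measurable_fun setT h -> {ae marginal pi, forall x, `|eta x - h x| <= e} ->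
  excess_risk pi eta (plug_in h) <= (c0 * e) `^ (kappa / (kappa - 1)).
Proof.
move=> k1 c00 e0 MA mh eta_h; apply: powR_self_bound => //; first exact: mulr_ge0.
rewrite -lee_fin; apply: le_trans (excess_risk_plug_in mh eta_h) _.
rewrite [c0 * e]mulrC -mulrA [leRHS]EFinM.
apply: lee_wpmul2l; first by rewrite lee_fin.
exact: MA (prediction_rule_plug_in mh).
Qed.

(** The opposite of the Bayes rule is at distance 2 from it everywhere, while its
    excess risk is at most 1. *)
Lemma margin_constant_ge2 kappa c0 : 0 < kappa -> 0 <= c0 ->
  margin_assumption kappa c0 pi eta -> 2 <= c0.
Proof.
move=> k0 c00 MA; have [meta _ _] := eta_reg.
have [mb b1] := prediction_rule_bayes meta.
pose f x := - bayes_rule eta x.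
have fr : prediction_rule f.
  split; first exact: measurable_funN.
  by move=> x; rewrite /f; case: (b1 x) => ->; rewrite ?opprK; [right|left].
have := MA f fr; rewrite (_ : (fun z : obs => _) = cst 2); last first.
  apply/funext => z; rewrite /f /=; case: (b1 z.1) => ->.
    by rewrite -opprD normrN ger0_norm; lra.
  by rewrite opprK ger0_norm; lra.
rewrite expectation_cst lee_fin => /le_trans; apply.
rewrite ler_piMr//; have fe1 := excess_risk_le1 fr.1.
(* A power with negative base is 1 by convention. *)
have [/lt0_powR1 ->//|x0] := ltP (excess_risk pi eta f) 0.
have := @ge0_ler_powR _ kappa^-1 _ (excess_risk pi eta f) 1.
rewrite powR1; apply; rewrite ?nnegrE// invr_ge0; exact: ltW.
Qed.

(** A density on the cube integrates to 1 against a probability. *)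
Lemma density_bound_ge1 mu_max : bounded_density mu_max pi -> 1 <= mu_max.
Proof.
move=> [_ [q [mq q01 qE]]].
have := qE setT measurableT; rewrite probability_setT => q1.
rewrite -lee_fin q1.
have -> : (mu_max%:E = \int[@cube_lebesgue R d]_x (cst mu_max%:E x))%E.
  by rewrite integral_cst//= probability_setT mule1.
apply: ge0_le_integral => //.
- by move=> x _; rewrite lee_fin; case/andP: (q01 x).
- exact/measurable_EFinP.
- by move=> x _; rewrite lee_fin; case/andP: (q01 x).
Qed.

Lemma ae_marginal mu_max (Q : input -> Prop) : bounded_density mu_max pi ->
  {ae @cube_lebesgue R d, forall x, Q x} -> {ae marginal pi, forall x, Q x}.
Proof.
move=> [/null_content_dominatesP dom _] [N [mN N0 NQ]].
by exists N; split=> //; exact: dom.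
Qed.

End excess_risk.

(** * Nets and aggregates *)

Section nets.
Context {R : realType} {d : nat}.
Local Notation input := (d.-tuple R).

Lemma Lnormy_le (g h : input -> R) (e : R) :
  ('N[@cube_lebesgue R d]_+oo[EFin \o (g \- h)%R] <= e%:E)%E ->
  {ae @cube_lebesgue R d, forall x, `|g x - h x| <= e}.
Proof.
rewrite unlock /= probability_setT lte01 => /ess_supP.
by apply: filterS => x /=; rewrite lee_fin.
Qed.

Lemma close_constants (h : input -> R) (a b e : R) :
  {ae @cube_lebesgue R d, forall x, `|a - h x| <= e} ->
  {ae @cube_lebesgue R d, forall x, `|b - h x| <= e} -> `|a - b| <= 2 * e.
Proof.
move=> ah bh; have [x [ax bx]] := ae_exists (filterI ah bh).
rewrite (_ : a - b = (a - h x) - (b - h x)); last by ring.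
by apply: le_trans (ler_normB _ _) _; move: ax bx; lra.
Qed.

(** The constants 0, 1/2 and 1 are possible regression functions at mutual
    distance at least 1/2; a function within e < 1/4 of one of them is not within
    e of another, so that three points of the net are needed to approximate them.
    The oracle inequality requires at least three rules. *)
Lemma epsilon_net_ge3 (beta L e : R) (S : {fset (input -> R)}) :
  0 <= L -> e < 4^-1 -> epsilon_net beta L e S -> (3 <= #|` S|)%N.
Proof.
move=> L0 e4 [_ netP].
have near_cst c : 0 <= c <= 1 -> exists2 h, h \in S &
    {ae @cube_lebesgue R d, forall x, `|c - h x| <= e}.
  move=> c01; have [||h hS /Lnormy_le ch] := netP (cst c); last by exists h.
    exact: hoelder_class_cst.
  by move=> x _.
have [|h0 S0 H0] := near_cst 0; first lra.
have [|h1 S1 H1] := near_cst 2^-1; first lra.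
have [|h2 S2 H2] := near_cst 1; first lra.
have neq h h' (a b : R) : {ae @cube_lebesgue R d, forall x, `|a - h x| <= e} ->
    {ae @cube_lebesgue R d, forall x, `|b - h' x| <= e} ->
    2^-1 <= b - a -> h != h'.
  move=> ah bh' ab; apply/eqP => hh'; rewrite hh' in ah.
  have := close_constants bh' ah; have := ler_norm (b - a); lra.
have u : uniq [:: h0; h1; h2].
  rewrite /= !inE negb_or (neq _ _ _ _ H0 H1) ?(neq _ _ _ _ H0 H2)//; try lra.
  by rewrite (neq _ _ _ _ H1 H2)//; lra.
apply: (uniq_leq_size u) => h; rewrite !inE.
by case/or3P => /eqP ->.
Qed.

Lemma aggregate_reindex (I : finType) (f : I -> input -> R) n
    (s : n.-tuple (input * bool)) :
  aggregate f s = aggregate (fun j : 'I_#|I| => f (enum_val j)) s.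
Proof.
have bij := onW_bij predT (@enum_val_bij I).
by apply/funext => x; rewrite /aggregate (reindex _ bij) [in LHS](reindex _ bij).
Qed.

Lemma measurable_aggregate (I : finType) (f : I -> input -> R) n
    (s : n.-tuple (input * bool)) :
  (forall j, measurable_fun setT (f j)) -> measurable_fun setT (aggregate f s).
Proof.
move=> mf; apply: measurable_sum => j.
exact: measurable_funM.
Qed.

End nets.

(** * Rates *)

Lemma rate_denominator_gt0 (R : realType) (d : nat) (kappa beta : R) :
  1 < kappa -> 0 < beta -> 0 < rate_denominator d kappa beta.
Proof.
move=> k1 b0; have k2 : 0 <= kappa - 1 by lra.
have k3 : 0 < 2 * kappa - 1 by lra.
by rewrite /rate_denominator ltr_pwDl ?mulr_gt0 ?mulr_ge0.
Qed.

Lemma epsilon_n_gt0 (R : realType) (d n : nat) (kappa beta a1 : R) :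
  0 < a1 -> (1 <= n)%N -> 0 < epsilon_n d kappa beta a1 n.
Proof. by move=> a10 n1; rewrite /epsilon_n mulr_gt0// powR_gt0// ltr0n. Qed.

(** The choice of epsilon_n makes its power kappa / (kappa - 1) equal to the
    target rate up to a power of a1.  The constant 8 is twice the factor
    2 (1 + a) of the oracle inequality at a = 1: the two terms of that inequality
    are each bounded by half of the claimed bound. *)
Lemma approximation_rate (R : realType) (d n : nat)
    (kappa beta c0 mu_max a1 A C : R) :
  1 < kappa -> 0 < beta -> 0 <= c0 -> 0 <= mu_max -> 0 < a1 -> (1 <= n)%N ->
  8 * (2 * c0 * mu_max * epsilon_n d kappa beta a1 n) `^ (kappa / (kappa - 1))
    <= C2 d kappa beta c0 mu_max a1 A C
       * n%:R `^ (- (beta * kappa / rate_denominator d kappa beta)).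
Proof.
move=> k1 b0 c00 mu0 a10 n1.
have e0 : 0 < epsilon_n d kappa beta a1 n by exact: epsilon_n_gt0.
have D0 := rate_denominator_gt0 d k1 b0.
have k0 : kappa - 1 != 0 by rewrite subr_eq0 gt_eqF.
rewrite powRM ?(ltW e0) ?mulr_ge0//.
have -> : epsilon_n d kappa beta a1 n `^ (kappa / (kappa - 1)) =
    a1 `^ (kappa / (kappa - 1))
      * n%:R `^ (- (beta * kappa / rate_denominator d kappa beta)).
  rewrite /epsilon_n powRM ?powR_ge0 ?(ltW a10)// -powRrM; congr (_ * _ `^ _).
  by field; rewrite k0 gt_eqF.
rewrite !mulrA ler_wpM2r ?powR_ge0// /C2.
rewrite (_ : 8 = 2 * 4); last by ring.
rewrite -[2 * 4 * _]mulrA; apply: ler_pM; rewrite ?mulr_ge0 ?powR_ge0//.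
- by rewrite ler_pM2l// le_max lexx.
- by rewrite le_max lexx.
Qed.

(** With epsilon_n the entropy term has the same power of n as the approximation
    term.  The power of a1 that comes out has exponent - u / (2 kappa - 1), with
    u = d kappa / beta; it is at most the last factor of C2, whose two powers of a1
    cover a1 > 1 and a1 <= 1 respectively. *)
Lemma entropy_rate (R : realType) (d n : nat)
    (kappa beta c0 mu_max a1 A C : R) :
  1 < kappa -> 0 < beta -> 0 < a1 -> 0 <= A -> 0 <= C -> (1 <= n)%N ->
  2 * (C * (A * epsilon_n d kappa beta a1 n `^ (- (d%:R / beta)) / n%:R)
             `^ (kappa / (2 * kappa - 1)))
    <= C2 d kappa beta c0 mu_max a1 A C
       * n%:R `^ (- (beta * kappa / rate_denominator d kappa beta)).
Proof.
move=> k1 beta_gt0 a1_gt0 A0 C0 n1.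
have e0 : 0 < epsilon_n d kappa beta a1 n by exact: epsilon_n_gt0.
have D0 := rate_denominator_gt0 d k1 beta_gt0.
have n0 : 0 < n%:R :> R by rewrite ltr0n.
have k0 : 0 < kappa by lra.
have k2 : 0 < kappa - 1 by lra.
have k3 : 0 < 2 * kappa - 1 by lra.
have beta_neq0 : beta != 0 by rewrite gt_eqF.
pose u : R := d%:R * kappa / beta.
have u0 : 0 <= u by rewrite divr_ge0 ?mulr_ge0// ltW.
have -> : (A * epsilon_n d kappa beta a1 n `^ (- (d%:R / beta)) / n%:R)
      `^ (kappa / (2 * kappa - 1)) =
    A `^ (kappa / (2 * kappa - 1)) * a1 `^ (- (u / (2 * kappa - 1)))
      * n%:R `^ (- (beta * kappa / rate_denominator d kappa beta)).
  rewrite -[A * _ / _]mulrA powRM ?mulr_ge0 ?powR_ge0 ?invr_ge0 ?(ltW n0)//.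
  rewrite -[RHS]mulrA; congr (_ * _).
  rewrite /epsilon_n -(powR_inv1 (ltW n0)).
  rewrite [((_ * _) `^ _ * _) `^ _]powRM ?powR_ge0//.
  rewrite [(a1 * _) `^ _]powRM ?powR_ge0 ?(ltW a1_gt0)//.
  rewrite [(a1 `^ _ * _) `^ _]powRM ?powR_ge0// -!powRrM.
  rewrite -[_ * _ * n%:R `^ _]mulrA -powRD; last by rewrite (gt_eqF n0) implybT.
  congr (_ `^ _ * _ `^ _).
    by rewrite /u; field; rewrite beta_neq0 gt_eqF.
  move: D0; rewrite /rate_denominator => D0; field.
  by rewrite beta_neq0 !gt_eqF.
have a1u : a1 `^ (- (u / (2 * kappa - 1))) <=
    Num.max (a1 `^ (kappa / (kappa - 1)))
            (a1 `^ (- (d%:R * kappa / (beta * (kappa - 1))))).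
  have uE : d%:R * kappa / (beta * (kappa - 1)) = u / (kappa - 1).
    by rewrite /u; field; apply/andP; split; rewrite gt_eqF.
  (* For a1 <= 1 a more negative exponent increases the power; for a1 > 1 a
     negative exponent makes it less than 1. *)
  rewrite uE le_max; have [a1_le1|a1_gt1] := leP a1 1; apply/orP; [right|left].
    apply: ger_powR; first by rewrite a1_gt0.
    by rewrite lerN2 ler_wpM2l// lef_pV2 ?posrE//; lra.
  apply: ler_powR; first exact: ltW.
  by rewrite (@le_trans _ _ 0)// ?oppr_le0 divr_ge0// ltW.
rewrite !mulrA ler_wpM2r ?powR_ge0// /C2.
apply: ler_pM => //; rewrite ?mulr_ge0 ?powR_ge0//.
by rewrite -mulrA ler_pM2l// le_max lexx orbT.
Qed.

(** * The rate of convergence *)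

Theorem theorem4 (R : realType) (d : nat)
    (kappa beta L c0 mu_max a1 A C : R)
    (net : R -> {fset (d.-tuple R -> R)})
    (d_gt0 : (0 < d)%N) (kappa_gt1 : 1 < kappa) (beta_gt0 : 0 < beta)
    (L_gt0 : 0 < L) (c0_gt0 : 0 < c0) (a1_gt0 : 0 < a1) (C_gt0 : 0 < C)
    (oracle : oracle_inequality (d := d) kappa c0 1 C)
    (net_ok : forall eps : R, 0 < eps -> epsilon_net beta L eps (net eps))
    (net_card : forall eps : R, 0 < eps ->
      ln (#|` net eps|%:R : R) <= A * eps `^ (- (d%:R / beta)))
    (pi : probability (d.-tuple R * bool)%type R) (eta : d.-tuple R -> R)
    (pi_model : model kappa beta L c0 mu_max pi eta)
    (n : nat) (n_ge1 : (1 <= n)%N) :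
  ('E_(prob_power pi n)[fun s =>
      excess_risk pi eta
        (net_aggregate (net (epsilon_n d kappa beta a1 n)) s)]
    <= (C2 d kappa beta c0 mu_max a1 A C
        * n%:R `^ (- (beta * kappa / rate_denominator d kappa beta)))%:E)%E.
Proof.
have [pi_cube eta_reg MA dens eta_hoelder] := pi_model.
have [c0_ge0 L_ge0 C_ge0] := And3 (ltW c0_gt0) (ltW L_gt0) (ltW C_gt0).
have kappa_gt0 : 0 < kappa by lra.
have mu_ge1 := density_bound_ge1 dens.
have mu_ge0 : 0 <= mu_max by lra.
have c0_ge2 := margin_constant_ge2 eta_reg kappa_gt0 c0_ge0 MA.
set e := epsilon_n d kappa beta a1 n.
have e_gt0 : 0 < e by exact: epsilon_n_gt0.
have [net_meas netP] := net_ok e e_gt0.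
have exponent_ge0 : 0 <= kappa / (kappa - 1) by rewrite divr_ge0; lra.
have plug_in_rule (h : net e) : prediction_rule (plug_in (val h)).
  by apply: prediction_rule_plug_in; exact: net_meas (valP h).
have approx :=
  approximation_rate d A C kappa_gt1 beta_gt0 c0_ge0 mu_ge0 a1_gt0 n_ge1.
(* A net at a scale e >= 1/4 may have fewer than three points.  The claimed bound
   is then at least 8, since 2 c0 mu_max e >= 4 e >= 1, while the excess risk is at
   most 1. *)
have [e_ge|e_lt] := leP 4^-1 e.
  apply: (@le_trans _ _ 1%:E).
    apply: expectation_le_cst => // s.
    apply: excess_risk_le1 => //; apply: measurable_aggregate => h.
    exact: (plug_in_rule h).1.
  rewrite lee_fin; apply: le_trans approx; rewrite -/e.
  have : 1 <= (2 * c0 * mu_max * e) `^ (kappa / (kappa - 1)).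
    rewrite -[leLHS](powRr0 (2 * c0 * mu_max * e)); apply: ler_powR => //.
    have c0_mu : 2 * 1 <= c0 * mu_max by rewrite ler_pM.
    have : 2 * 4^-1 <= c0 * mu_max * e.
      by rewrite ler_pM// -[2]mulr1.
    rewrite -[2 * c0 * _]mulrA -[2 * _ * _]mulrA.
    by lra.
  lra.
have M3 := epsilon_net_ge3 L_ge0 e_lt (net_ok e e_gt0).
have lnM_gt0 : 0 < ln (#|` net e|%:R : R).
  by rewrite ln_gt0// ltr1n (leq_trans _ M3).
(* A net of several points has positive entropy, and A bounds it from above up to
   a positive factor. *)
have A_ge0 : 0 <= A.
  have := lt_le_trans lnM_gt0 (net_card e e_gt0).
  by rewrite pmulr_lgt0 ?powR_gt0// => /ltW.
have entropy :=
  entropy_rate d c0 mu_max kappa_gt1 beta_gt0 a1_gt0 A_ge0 C_ge0 n_ge1.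
have [_ eta01 _] := eta_reg.
have [h hS /Lnormy_le /(ae_marginal dens) eta_h] := netP eta eta_hoelder eta01.
have h_excess : excess_risk pi eta (plug_in h) <=
    (2 * c0 * mu_max * e) `^ (kappa / (kappa - 1)).
  apply: le_trans (excess_risk_plug_in_margin eta_reg kappa_gt1 c0_ge0
    (ltW e_gt0) MA (net_meas h hS) eta_h) _.
  apply: ge0_ler_powR => //; rewrite ?nnegrE ?(mulr_ge0 _ (ltW e_gt0)) ?mulr_ge0//.
  rewrite ler_wpM2r ?(ltW e_gt0)// -[2 * _ * _]mulrAC ler_peMl//.
  by lra.
pose f (j : 'I_#|{: net e}|) := plug_in (val (enum_val j)).
rewrite (_ : (fun s : n.-tuple _ => _) =
    (fun s => excess_risk pi eta (aggregate f s))); last first.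
  by apply/funext => s; rewrite /net_aggregate aggregate_reindex.
have M3' : (3 <= #|{: net e}|)%N by rewrite -cardfE.
apply: le_trans (oracle pi eta pi_cube eta_reg MA n _ f n_ge1 M3' _) _.
  by move=> j; exact: plug_in_rule.
apply: (@le_trans _ _
  ((4 * (2 * c0 * mu_max * e) `^ (kappa / (kappa - 1)))%:E
  + (C * (A * e `^ (- (d%:R / beta)) / n%:R) `^ (kappa / (2 * kappa - 1)))%:E)%E);
  last first.
  by rewrite -EFinD lee_fin; move: approx entropy; rewrite -/e; lra.
apply: leeD.
  rewrite (_ : 2 * (1 + 1) = 4 :> R) ?[leRHS]EFinM; last by ring.
  apply: lee_wpmul2l; first by rewrite lee_fin.
  apply: (@bigmin_inf _ _ _ _ (enum_rank [` hS]%fset)) => //.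
  by rewrite lee_fin /f enum_rankK.
rewrite lee_fin ler_wpM2l//; apply: ge0_ler_powR.
- by rewrite divr_ge0; lra.
- by rewrite nnegrE divr_ge0// -cardfE ltW.
- by rewrite nnegrE divr_ge0// mulr_ge0// powR_ge0.
- by rewrite ler_wpM2r ?invr_ge0// -cardfE net_card.
Qed.
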